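(* Let $(W,S)$ be a Coxeter system with $S$ finite (not necessarily finite or irreducible $W$). For any $v\in W$, the set of elements $w\ge v$ in the right weak order such that $[v,w]$ is a Boolean interval (including $w=v$) is in bijection with the collection of independent sets (including the empty set) of the induced subgraph $\Gamma_W[S\setminus\mathrm{Des}(v)]$ of the Coxeter graph obtained by deleting the elements of $\mathrm{Des}(v)$ from its vertex set.
   Context: The Coxeter matrix $m$ of $(W,S)$ has $m(s,s')$ the order of $ss'$. The Coxeter graph $\Gamma_W$ has vertex set $S$ and an edge between $s,s'$ iff $m(s,s')\ge 3$ (so two generators commute iff they are non-adjacent). The right weak order on $W$: $u\le w$ iff $\ell(w)=\ell(u)+\ell(u^{-1}w)$, where $\ell$ is Coxeter length. $\mathrm{Des}(v)=\{s\in S:\ell(vs)=\ell(v)-1\}$. An interval is Boolean if it is isomorphic to the lattice of subsets of a finite set. An independent set of a graph is a set of vertices no two of which are adjacent. *)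

(* Defs.v *)
From HB Require Import structures.
From mathcomp Require Import all_boot finmap.
From mathcomp Require Import boolp classical_sets functions.

Set Implicit Arguments.
Unset Strict Implicit.
Unset Printing Implicit Defensive.

Local Open Scope group_scope.

(* A letter [(x, true)] stands for the generator [x], and [(x, false)] for its
   inverse, so that [seq (X * bool)] is the type of (unreduced) words of the
   free group on [X]. *)
Inductive pres_cong (X : Type) (R : seq (X * bool) -> Prop) :
    seq (X * bool) -> seq (X * bool) -> Prop :=
| PresRefl u : pres_cong R u u
| PresSym u v : pres_cong R u v -> pres_cong R v u
| PresTrans u v w : pres_cong R u v -> pres_cong R v w -> pres_cong R u w
| PresCat u u' v v' :
    pres_cong R u u' -> pres_cong R v v' -> pres_cong R (u ++ v) (u' ++ v')
| PresCancel x b : pres_cong R [:: (x, b); (x, ~~ b)] [::]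
| PresRel r : R r -> pres_cong R r [::].

Definition word_eval (G : groupType) (X : Type) (g : X -> G)
    (u : seq (X * bool)) : G :=
  \prod_(l <- u) (if l.2 then g l.1 else (g l.1)^-1).

(* [G] is presented by the generators [g x] subject to the relators in [R]. *)
Definition presented_by (G : groupType) (X : Type) (g : X -> G)
    (R : seq (X * bool) -> Prop) : Prop :=
  (forall a : G, exists u, word_eval g u = a) /\
  (forall u v, word_eval g u = word_eval g v <-> pres_cong R u v).

(* [None] stands for infinite order. *)
Definition elt_order (G : groupType) (x : G) : option nat :=
  match pselect (exists n, (0 < n) && (x ^+ n == 1)) with
  | left h => Some (ex_minn h)
  | right _ => None
  end.

Section Coxeter.
Variables (W : groupType) (S : {fset W}).

Definition cox_matrix (s t : S) : option nat := elt_order (val s * val t).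

Definition cox_relator (r : seq (S * bool)) : Prop :=
  exists (s t : S) (n : nat),
    cox_matrix s t = Some n /\
    r = flatten (nseq n [:: (s, true); (t, true)]).

Definition coxeter_system : Prop :=
  (forall s : S, elt_order (val s) = Some 2) /\
  presented_by (fun s : S => val s) cox_relator.

Definition cox_edge : rel S :=
  fun s t => if cox_matrix s t is Some n then 3 <= n else true.

(* Since the elements of [S] are involutions, positive words suffice. *)
Definition is_word_length (w : W) (n : nat) : bool :=
  [exists t : n.-tuple S, \prod_(s <- t) val s == w].

(* The value 0 in the second branch is never used when [S] generates [W]. *)
Definition cox_length (w : W) : nat :=
  match pselect (exists n, is_word_length w n) with
  | left h => ex_minn h
  | right _ => 0
  end.

Definition weak_le : rel W :=
  fun u w => cox_length w == (cox_length u + cox_length (u^-1 * w)%g)%N.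

(* [l(vs) = l(v) - 1], written so as to avoid truncated subtraction. *)
Definition Des (v : W) : {set S} :=
  [set s : S | (cox_length (v * val s)%g).+1 == cox_length v]%SET.

Definition weak_interval (v w : W) : set W :=
  [set x | weak_le v x && weak_le x w]%classic.

Definition boolean_interval (v w : W) : Prop :=
  exists (X : finType) (f : {set X} -> W),
    set_bij [set: {set X}]%classic (weak_interval v w) f /\
    (forall A B : {set X}, (A \subset B) = weak_le (f A) (f B)).

End Coxeter.

Arguments cox_edge {W} S s t : rename.

Definition induced_subgraph (T : finType) (e : rel T) (X : {set T}) :
  rel {x : T | x \in X} := fun x y => e (val x) (val y).

Arguments induced_subgraph {T} e X x y.

Definition independent (T : finType) (e : rel T) (I : {set T}) : Prop :=
  {in I &, forall x y, x != y -> ~~ e x y}.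

(* Main.v *)
(* For a word [c] and [x] in [W], count modulo 2 the letters of [c] whose
   deletion amounts to right multiplication by [x].  This parity is a cocycle
   that vanishes on the Coxeter relators, so it depends only on the element
   spelled by [c]; hence it detects right descents, and the exchange condition
   follows.  If [J] consists of commuting generators outside [Des v], the cocycle
   identity gives l(v w_A) = l(v) + |A| for every A in J, where w_A is the
   product of A, and exchange shows that every element of [v, v w_J] has the
   form v w_A: this interval is Boolean.  Conversely, in a Boolean interval
   [v, w] each square v s < v s t' = v t s' > v t forces s' = s and t' = t, so
   the atoms v s of [v, w] come from commuting generators and w is v times
   their product.  The bijection sends w to the set of s with v < v s <= w. *)

Require Import Defs.
From mathcomp Require Import all_boot finmap.
From mathcomp Require Import boolp classical_sets functions.

Set Implicit Arguments.
Unset Strict Implicit.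
Unset Printing Implicit Defensive.

Local Open Scope group_scope.

Lemma elt_order_SomeP (G : groupType) (x : G) n : elt_order x = Some n ->
  [/\ 0 < n, x ^+ n = 1 & forall m, 0 < m -> x ^+ m = 1 -> n <= m].
Proof.
rewrite /elt_order; case: pselect => // h [<-].
case: ex_minnP => m /andP[m_gt0 /eqP xm] m_min; split=> // k k_gt0 xk.
by apply: m_min; rewrite k_gt0 xk eqxx.
Qed.

(** * Words in the generators, the reflection parity, and products over sets *)

Section Words.
Variables (W : groupType) (S : {fset W}).
Implicit Types (s t : S) (c d p q : seq S) (x : W).

Definition word_prod c : W := \prod_(s <- c) val s.

Lemma word_prod_nil : word_prod [::] = 1.
Proof. exact: big_nil. Qed.

Lemma word_prod_cons s c : word_prod (s :: c) = val s * word_prod c.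
Proof. exact: big_cons. Qed.

Lemma word_prod1 s : word_prod [:: s] = val s.
Proof. by rewrite word_prod_cons word_prod_nil mulg1. Qed.

Lemma word_prod_cat c d : word_prod (c ++ d) = word_prod c * word_prod d.
Proof. exact: big_cat. Qed.

Lemma word_prod_rcons c s : word_prod (rcons c s) = word_prod c * val s.
Proof. by rewrite -cats1 word_prod_cat word_prod1. Qed.

Lemma word_prod_pow s t n :
  word_prod (flatten (nseq n [:: s; t])) = (val s * val t) ^+ n.
Proof.
elim: n => [|n IHn]; first exact: word_prod_nil.
by rewrite /= !word_prod_cons IHn expgS mulgA.
Qed.

(* The parity of the number of letters [a] of [c = p ++ a :: q] whose deletion
   amounts to right multiplication by [x], i.e. with [x = q^-1 a q]. *)
Fixpoint refl_parity c x : bool :=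
  if c is a :: q then
    (word_prod q * x * (word_prod q)^-1 == val a) (+) refl_parity q x
  else false.

(** Cocycle identity: a letter followed by [q] in [c] is followed by [q ++ d] in [c ++ d], so [x] is
    conjugated first by [d] and then by [q]. *)
Lemma refl_parity_cat c d x :
  refl_parity (c ++ d) x =
  refl_parity c (word_prod d * x * (word_prod d)^-1) (+) refl_parity d x.
Proof.
elim: c => [|a c IHc] //=.
by rewrite IHc word_prod_cat invgM !mulgA addbA.
Qed.

Definition commuting (J : {set S}) : Prop :=
  {in J &, forall s t, commute (val s) (val t)}.

(** The order of the factors given by [enum] is immaterial as soon as [A] is commuting. *)
Definition set_prod (A : {set S}) : W := word_prod (enum A).

Lemma commute_word_prod x c :
  {in c, forall s, commute x (val s)} -> commute x (word_prod c).
Proof.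
elim: c => [|s c IHc] comm; first by rewrite word_prod_nil; apply: commute1.
rewrite word_prod_cons; apply: commuteM; first exact/comm/mem_head.
by apply: IHc => t ct; apply: comm; rewrite inE ct orbT.
Qed.

Lemma perm_word_prod c d :
  {in c &, forall s t, commute (val s) (val t)} -> perm_eq c d ->
  word_prod c = word_prod d.
Proof.
elim: c d => [|s c IHc] d comm cd.
  by move: cd; rewrite perm_sym => /perm_nilP ->.
have sd : s \in d by rewrite -(perm_mem cd) mem_head.
move: cd; case/splitPr: sd => p q.
rewrite perm_sym perm_catC /= perm_cons perm_catC perm_sym => cpq.
have sp : commute (val s) (word_prod p).
  apply: commute_word_prod => t pt; apply: comm; first exact: mem_head.
  by rewrite inE (perm_mem cpq) mem_cat pt orbT.
rewrite word_prod_cons (IHc (p ++ q)) // => [|t u ct cu].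
  by rewrite !word_prod_cat word_prod_cons !mulgA sp.
by apply: comm; rewrite inE ?ct ?cu orbT.
Qed.

End Words.

(** * Generators as involutions, and invariance of the parity *)

Section CoxeterSystem.
Variables (W : groupType) (S : {fset W}).
Hypothesis cox : coxeter_system S.
Implicit Types (s t : S) (c d p q : seq S) (v w x y z : W) (A B J : {set S}).

Local Notation len := (cox_length S).
Local Notation word_prod := (@word_prod W S).
Local Notation refl_parity := (@refl_parity W S).

Lemma gen_sqr s : val s * val s = 1.
Proof. by have [/(_ s)/elt_order_SomeP[_]] := cox. Qed.

Lemma gen_neq1 s : val s != 1.
Proof.
have [/(_ s)/elt_order_SomeP[_ _ min2] _] := cox.
by apply/eqP => s1; have := min2 1%N isT; rewrite expg1 => /(_ s1).
Qed.

Lemma genV s : (val s)^-1 = val s.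
Proof. exact: mulg1_eq (gen_sqr s). Qed.

Lemma mulg_genK s x : x * val s * val s = x.
Proof. by rewrite -mulgA gen_sqr mulg1. Qed.

Lemma mul_genK s x : val s * (val s * x) = x.
Proof. by rewrite mulgA gen_sqr mul1g. Qed.

Lemma word_eval_gen (u : seq (S * bool)) :
  word_eval (fun s => val s) u = word_prod (map fst u).
Proof.
rewrite /word_eval /word_prod big_map; apply: eq_bigr => -[s b] _ /=.
by case: b => //; rewrite genV.
Qed.

(** Read from the right, the letters of [(st)^n] yield [t], [tst], [tstst] and so on, that is
    [t (st)^i] for [i < 2n]. *)
Lemma refl_parity_pow s t n x :
  refl_parity (flatten (nseq n [:: s; t])) x =
  \big[addb/false]_(0 <= i < n + n) (x == val t * (val s * val t) ^+ i).
Proof.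
elim: n => [|n IHn]; first by rewrite big_nil.
rewrite addSn addnS !big_nat_recr //= -IHn word_prod_cons word_prod_pow.
set R := (val s * val t) ^+ n.
(* Conjugation by [t] inverts [st]. Hence conjugating [t] and [tst] by [R] gives the two new terms,
   with exponents [2n] and [2n + 1]. *)
have RV : R^-1 = val t * R * val t.
  rewrite -[_ * R * _]mulgA -{1}(genV t) -conjgE conjXg conjgE genV.
  by rewrite -mulgA gen_sqr mulg1 -expVgn invgM !genV.
have conjE y : (R * x * R^-1 == y) = (x == R^-1 * y * R).
  apply/eqP/eqP => [<-|->]; first by rewrite !mulgA mulgVK mulVg mul1g.
  by rewrite !mulgA mulgV mul1g mulgK.
have -> : val t * R * x * (val t * R)^-1 = val t * (R * x * R^-1) * val t.
  by rewrite invgM genV !mulgA.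
have -> : (val t * (R * x * R^-1) * val t == val s) =
          (R * x * R^-1 == val t * val s * val t).
  apply/eqP/eqP => [<-|->]; first by rewrite !mulgA gen_sqr mul1g mulg_genK.
  by rewrite -!mulgA gen_sqr mulg1 mul_genK.
rewrite !conjE RV addbA addbC [X in _ (+) X = _]addbC -[RHS]addbA.
rewrite -[(n + n).+1]addnS !expgnDr expgS -/R.
by rewrite !mulgA !mulg_genK.
Qed.


Lemma refl_parity_wd c d :
  word_prod c = word_prod d -> refl_parity c =1 refl_parity d.
Proof.
(* The induction runs over the congruence of signed words. [pos] lifts positive words there, and
   forgetting signs preserves the product because generators are involutions. *)
pose pos : seq S -> seq (S * bool) := map (fun s => (s, true)).
have posK e : map fst (pos e) = e by rewrite -map_comp map_id.
rewrite -(posK c) -(posK d) -!word_eval_gen; have [_ [_ pres]] := cox.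
move=> /pres; elim: {c d}(pos c) (pos d) / =>
  [u|u v _ IH|u v w _ IH1 _ IH2|u u' v v' /pres uu' IHu /pres vv' IHv|s b|
   r [s [t [n [e ->]]]]] x.
- by [].
- by rewrite IH.
- by rewrite IH1 IH2.
- by rewrite !map_cat !refl_parity_cat -!word_eval_gen vv' IHu IHv.
- rewrite /= word_prod1 word_prod_nil invg1 !mul1g mulg1 genV addbF.
  suff -> : (val s * x * val s == val s) = (x == val s) by rewrite addbb.
  apply/eqP/eqP => [e|->]; last by rewrite mulg_genK.
  by rewrite -[x](mul_genK s) -[val s * x](mulg_genK s) e gen_sqr mulg1.
(* Since [(st)^n = 1], the [2n] reflections repeat with period [n], and the two halves of the sum
   cancel. *)
- rewrite map_flatten map_nseq refl_parity_pow.
  have [_ stn _] := elt_order_SomeP e.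
  rewrite (@big_cat_nat _ _ _ n) ?leq_addl //=.
  rewrite -{2}[n]add0n big_addn addnK.
  under [X in _ (+) X]eq_bigr => i _ do rewrite expgnDr stn mulg1.
  exact: addbb.
Qed.

(** An odd count is nonzero, so some letter satisfies [x = q^-1 a q]; then [a q x = q], and
    appending [x] erases that letter. *)
Lemma refl_parity_exchange c x : refl_parity c x ->
  exists p a q, c = p ++ a :: q /\ word_prod c * x = word_prod (p ++ q).
Proof.
elim: c => [|a c IHc] //=.
case: eqP => [ca _|_ /= /IHc[p [b [q [-> e]]]]].
  exists [::], a, c; split => //.
  have cx : word_prod c * x = val a * word_prod c by rewrite -[val a]ca mulgVK.
  by rewrite word_prod_cons -mulgA cx mul_genK.
exists (a :: p), b, q; split => //.
by rewrite /= !word_prod_cons -mulgA e.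
Qed.

(** * Coxeter length *)

Lemma is_word_lengthP w n :
  reflect (exists2 c, word_prod c = w & size c = n) (is_word_length S w n).
Proof.
apply: (iffP existsP) => [[c /eqP cw]|[c cw /eqP sc]].
  by exists (tval c); rewrite ?size_tuple.
by exists (Tuple sc); apply/eqP.
Qed.

Lemma reduced_word w : exists2 c, word_prod c = w & size c = len w.
Proof.
rewrite /cox_length; case: pselect => [h|[]].
  by case: ex_minnP => n /is_word_lengthP.
(* Generation rules out the default value 0: dropping the signs of a signed word for [w] gives a
   positive one. *)
have [_ [/(_ w)[u]]] := cox; rewrite word_eval_gen => uw _.
by exists (size (map fst u)); apply/is_word_lengthP; exists (map fst u).
Qed.

Lemma len_word c : len (word_prod c) <= size c.
Proof.
rewrite /cox_length; case: pselect => // h.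
by case: ex_minnP => n _; apply; apply/is_word_lengthP; exists c.
Qed.

Lemma lenM x y : len (x * y) <= len x + len y.
Proof.
have [c <- <-] := reduced_word x; have [d <- <-] := reduced_word y.
by rewrite -word_prod_cat -size_cat len_word.
Qed.

Lemma len1 : len 1 = 0.
Proof. by apply/eqP; rewrite -leqn0 -(@word_prod_nil W S) len_word. Qed.

Lemma len_eq0 x : len x = 0 -> x = 1.
Proof.
by have [c <- <-] := reduced_word x => /size0nil ->; apply: word_prod_nil.
Qed.

Lemma len_gen s : len (val s) = 1%N.
Proof.
apply/eqP; rewrite eqn_leq -{1}word_prod1 len_word lt0n.
by apply: contraNneq (gen_neq1 s) => /len_eq0 ->.
Qed.

(** * Descents and the exchange condition *)

Lemma Des_parity c s : (s \in Des S (word_prod c)) = refl_parity c (val s).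
Proof.
have shorten d : refl_parity d (val s) -> len (word_prod d * val s) < size d.
  case/refl_parity_exchange=> p [a [q [-> ->]]].
  by rewrite -cat_rcons !size_cat size_rcons addSn ltnS -size_cat len_word.
set w := word_prod c; have le_w : len w <= (len (w * val s)).+1.
  by rewrite -{1}(mulg_genK s w) -addn1 -(len_gen s) lenM.
rewrite inE; case c_s: (refl_parity c (val s)).
  (* By invariance the odd parity is also that of a reduced word, where deleting a letter lowers the
     length. *)
  have [d dw sd] := reduced_word w; have := shorten d.
  rewrite dw sd (@refl_parity_wd d c) // => /(_ c_s) lt_w.
  by rewrite eqn_leq lt_w.
(* Even parity for [w] becomes odd for [w s], so the same argument makes [w] shorter than [w s]. *)
have [d ds sd] := reduced_word (w * val s).
have /shorten : refl_parity d (val s).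
  rewrite (@refl_parity_wd d (rcons c s)) ?word_prod_rcons //.
  by rewrite -cats1 refl_parity_cat /= word_prod1 word_prod_nil genV
    mulg_genK mul1g invg1 mulg1 c_s eqxx.
by rewrite ds mulg_genK sd; apply: contraTF => /eqP <-; rewrite ltnNge leqnSn.
Qed.

Lemma exchange c s : s \in Des S (word_prod c) ->
  exists p a q, c = p ++ a :: q /\ word_prod c * val s = word_prod (p ++ q).
Proof. by rewrite Des_parity => /refl_parity_exchange. Qed.

(** Appending [s] flips the parity at [s], so [s] is a descent of [v s] when it is not one of [v];
    the lengths of [v] and [v s] are never equal. *)
Lemma len_mul_gen v s : s \notin Des S v -> len (v * val s) = (len v).+1.
Proof.
have [c <- sc] := reduced_word v; rewrite Des_parity => c_s.
apply/eqP; rewrite eqn_leq -{1}addn1 -{1}(len_gen s) lenM /=.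
have: s \in Des S (word_prod (rcons c s)).
  by rewrite Des_parity -cats1 refl_parity_cat /= word_prod1 word_prod_nil genV
    mulg_genK mul1g invg1 mulg1 (negPf c_s) eqxx.
by rewrite inE word_prod_rcons mulg_genK => /eqP ->.
Qed.

Lemma Des1 : Des S 1 = finset.set0.
Proof. by apply/setP => s; rewrite !inE len1 eqn_leq ltn0. Qed.

Lemma Des_gen v s : len v < len (v * val s) -> s \notin Des S v.
Proof. by rewrite inE; apply: contraTN => /eqP <-; rewrite -leqNgt leqnSn. Qed.

(** Here [t] is a descent of [a s], since otherwise [a s = 1]. Exchange then leaves one letter of
    [a s], equal to [b], and it is not [a]. Applied from both sides, this turns a square of the weak
    order into a commutation. *)
Lemma two_letters a b s t : a != b -> a != s ->
  val a * val s = val b * val t :> W -> s = b.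
Proof.
move=> ab a_s e.
have z_t : val a * val s * val t = val b by rewrite e mulg_genK.
have: t \in Des S (word_prod [:: a; s]).
  apply: contraR a_s; rewrite !word_prod_cons word_prod_nil mulg1.
  move=> /len_mul_gen; rewrite z_t len_gen => -[/esym/len_eq0 a_s].
  by apply/eqP/val_inj; rewrite -(mulg_genK s (val a)) a_s mul1g.
case/exchange=> p [x [q [e' ]]]; rewrite !word_prod_cons word_prod_nil mulg1 z_t.
case: p e' => [|y [|y' [|? ?]]] //= [].
  by move=> _ <-; rewrite word_prod1 => /val_inj.
by move=> <- _ <-; rewrite word_prod1 => /val_inj ba; rewrite ba eqxx in ab.
Qed.

(** * Products of commuting generators *)

Lemma commuting_sub A B : A \subset B -> commuting B -> commuting A.
Proof. by move=> /fintype.subsetP AB comm s t /AB sB /AB tB; apply: comm. Qed.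

Lemma set_prod0 : set_prod (finset.set0 : {set S}) = 1.
Proof. by rewrite /set_prod enum_set0 word_prod_nil. Qed.

Lemma set_prod1 s : set_prod [set s]%SET = val s.
Proof. by rewrite /set_prod enum_set1 word_prod1. Qed.

Lemma set_prodD A B : commuting B -> A \subset B ->
  set_prod B = set_prod A * set_prod (B :\: A).
Proof.
move=> comm AB; rewrite /set_prod -word_prod_cat.
apply: perm_word_prod => [s t|]; first by rewrite !mem_enum; apply: comm.
apply: uniq_perm; rewrite ?cat_uniq ?enum_uniq ?andbT //=.
  by apply/hasPn => s; rewrite !mem_enum inE => /andP[].
move=> s; rewrite mem_cat !mem_enum inE.
by case sA: (s \in A) => //=; rewrite (fintype.subsetP AB).
Qed.

Lemma set_prodU1 A s : commuting (s |: A)%SET -> s \notin A ->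
  set_prod (s |: A)%SET = set_prod A * val s.
Proof.
move=> comm sA; rewrite (set_prodD comm (finset.subsetUr _ _)).
rewrite -set_prod1; congr (_ * set_prod _); apply/setP => t; rewrite !inE.
by case: eqP => [->|_] //=; case: (t \in A); rewrite ?sA.
Qed.

Lemma set_prodD1 A s : commuting A -> s \in A ->
  set_prod A = set_prod (A :\ s)%SET * val s.
Proof.
move=> comm sA; rewrite -set_prodU1 ?finset.setD1K //.
by rewrite !inE eqxx.
Qed.

(** Conjugation by any suffix fixes [s], which is none of the letters. *)
Lemma refl_parity_commuting c s :
  {in c, forall t, commute (val s) (val t)} -> s \notin c ->
  refl_parity c (val s) = false.
Proof.
elim: c => [|t c IHc] comm //=; rewrite inE negb_or => /andP[st sc].
have comm_c : {in c, forall u, commute (val s) (val u)}.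
  by move=> u uc; apply: comm; rewrite inE uc orbT.
by rewrite IHc // addbF -(commute_word_prod comm_c) mulgK; apply: contraNF st.
Qed.

Lemma len_mul_set v A : commuting A -> [disjoint A & Des S v] ->
  len (v * set_prod A) = (len v + #|A|)%N.
Proof.
elim: {A}_.+1 {-2}A (ltnSn #|A|) => // n IHn A; rewrite ltnS => An comm dis.
have [->|[s sA]] := finset.set_0Vmem A; first by
  rewrite set_prod0 mulg1 cards0 addn0.
have sub := finset.subD1set A s.
rewrite (set_prodD1 comm sA) mulgA (cardsD1 s A) sA addnCA add1n.
have comm' := commuting_sub sub comm.
rewrite -IHn ?(disjointWl sub) //; last first.
  by move: An; rewrite (cardsD1 s A) sA.
apply: len_mul_gen; have [c cv _] := reduced_word v.
have comm_s t : t \in enum (A :\ s)%SET -> commute (val s) (val t).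
  by rewrite mem_enum => /(fintype.subsetP sub) tA; apply: comm.
(* As [s] commutes with the rest of [A] and is not in it, the parity at [s] reduces to that of [c],
   which is even because [s] is not a descent of [v]. *)
rewrite -cv /set_prod -word_prod_cat Des_parity refl_parity_cat.
rewrite -(commute_word_prod comm_s) mulgK refl_parity_commuting //; last first.
  by rewrite mem_enum !inE eqxx.
by rewrite addbF -Des_parity cv (disjointFr dis).
Qed.

Lemma len_set A : commuting A -> len (set_prod A) = #|A|.
Proof.
move=> comm; rewrite -[set_prod A]mul1g len_mul_set ?len1 //.
by rewrite Des1 fintype.disjoint_sym; apply/pred0P => s; rewrite /= finset.in_set0.
Qed.

(** Exchange deletes some [a] in [A]; moving [a] to the end gives [w_A = w_A s a], whence
    [s = a]. *)
Lemma Des_set_prod A s : commuting A -> s \in Des S (set_prod A) -> s \in A.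
Proof.
move=> comm /exchange[p [a [q [Apaq As]]]].
have aA : a \in A by rewrite -mem_enum Apaq mem_cat mem_head orbT.
suff -> : s = a by [].
have: set_prod A = word_prod (p ++ q) * val a.
  rewrite -word_prod_rcons; apply: perm_word_prod => [t u|].
    by rewrite !mem_enum; apply: comm.
  by rewrite Apaq -cats1 -catA perm_cat2l -cat1s perm_catC.
rewrite -As -mulgA -{1}[set_prod A]mulg1 => /mulgI/esym sa1.
by apply/val_inj; rewrite -(mulg_genK a (val s)) sa1 mul1g.
Qed.

(** The last letter of a reduced word of [y] is a descent of [w_A], hence lies in [A], and can be
    stripped from both sides. *)
Lemma set_prod_prefix x y A : commuting A -> set_prod A = x * y ->
  (len x + len y)%N = #|A| -> exists2 B : {set S}, B \subset A & x = set_prod B.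
Proof.
have [d <- <-] := reduced_word y.
(* With [size d] in place of the length of [y], the induction need not track that [d] is reduced. *)
elim/last_ind: d A => [|d s IHd] A comm.
  by rewrite word_prod_nil mulg1 => <- _; exists A.
rewrite word_prod_rcons mulgA size_rcons addnS => e sz.
have es : set_prod A * val s = x * word_prod d by rewrite e mulg_genK.
have sA : s \in A.
  apply: Des_set_prod => //; apply: contraT => /len_mul_gen.
  rewrite es len_set // => /eqP; rewrite -sz ltn_eqF // ltnS.
  by apply: leq_trans (lenM _ _) _; rewrite leqW // leq_add2l len_word.
have sub := finset.subD1set A s.
case: (IHd (A :\ s)%SET) => [|||B BA ->]; first exact: commuting_sub comm.
- by rewrite -es (set_prodD1 comm sA) mulg_genK.
- by move: sz; rewrite (cardsD1 s A) sA => -[].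
- by exists B => //; apply: fintype.subset_trans sub.
Qed.

(** Lengths force equal cardinals; an [s] in [A] but not in [B] would shorten [w_A] and lengthen
    [w_B]. *)
Lemma set_prod_inj J A B : commuting J -> A \subset J -> B \subset J ->
  set_prod A = set_prod B -> A = B.
Proof.
move=> comm AJ BJ e; have [cA cB] := (commuting_sub AJ comm, commuting_sub BJ comm).
have cardAB : #|A| = #|B| by rewrite -!len_set ?e.
apply/eqP; rewrite eqEcard cardAB leqnn andbT; apply/fintype.subsetP => s sA.
apply: contraT => sB.
have sBJ : (s |: B)%SET \subset J.
  by rewrite finset.subUset finset.sub1set BJ (fintype.subsetP AJ).
have cU := commuting_sub sBJ comm; have := len_set cU.
rewrite (set_prodU1 cU sB) -e (set_prodD1 cA sA) mulg_genK.
rewrite (len_set (commuting_sub (finset.subD1set A s) cA)) cardsU1 sB -cardAB.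
by rewrite (cardsD1 s A) sA => /eqP; rewrite !add1n ltn_eqF.
Qed.

(** * The weak order and the intervals below [v w_J] *)

Lemma weak_le_refl x : weak_le S x x.
Proof. by rewrite /weak_le mulVg len1 addn0. Qed.

Lemma weak_le_trans x y z : weak_le S x y -> weak_le S y z -> weak_le S x z.
Proof.
move=> /eqP xy /eqP yz; rewrite /weak_le eqn_leq.
rewrite -{1}[z](mulVKg x) lenM /= yz xy -addnA leq_add2l.
by rewrite -[x^-1 * z](mulKg (x^-1 * y)^-1) invgK (leq_trans (lenM _ _)) //
  invgM invgK -!mulgA mulVKg.
Qed.

Lemma weak_le_set v A B : commuting B -> [disjoint B & Des S v] -> A \subset B ->
  weak_le S (v * set_prod A) (v * set_prod B).
Proof.
move=> comm dis AB; have [cA dA] := (commuting_sub AB comm, disjointWl AB dis).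
rewrite /weak_le !len_mul_set // invgM -mulgA mulKg (set_prodD comm AB) mulKg.
rewrite (len_set (commuting_sub (finset.subsetDl B A) comm)).
by rewrite -addnA -(cardsID A B) (finset.setIidPr AB).
Qed.

(** Cancelling the length of [v] leaves a length-additive factorization of [w_B] with left factor
    [v^-1 x]. *)
Lemma weak_le_set_interval v x B : commuting B -> [disjoint B & Des S v] ->
  weak_le S v x -> weak_le S x (v * set_prod B) ->
  exists2 A : {set S}, A \subset B & x = v * set_prod A.
Proof.
move=> comm dis /eqP vx /eqP; rewrite len_mul_set // vx -addnA => /eqP.
rewrite eqn_add2l => /eqP lens.
have [|||A AB e] := @set_prod_prefix (v^-1 * x) (x^-1 * (v * set_prod B)) B.
- by [].
- by rewrite -mulgA mulVKg mulKg.
- by [].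
by exists A => //; rewrite -e mulVKg.
Qed.

Lemma weak_le_set_sub v J A B : commuting J -> [disjoint J & Des S v] ->
  A \subset J -> B \subset J ->
  weak_le S (v * set_prod A) (v * set_prod B) -> A \subset B.
Proof.
move=> comm dis AJ BJ leAB.
have [cB dB] := (commuting_sub BJ comm, disjointWl BJ dis).
have [|A' A'B /mulgI] := weak_le_set_interval cB dB _ leAB.
  have := weak_le_set (commuting_sub AJ comm) (disjointWl AJ dis) (finset.sub0set A).
  by rewrite set_prod0 mulg1.
move=> /(set_prod_inj comm AJ) -> //; exact: fintype.subset_trans BJ.
Qed.

Lemma boolean_interval_set v J : commuting J -> [disjoint J & Des S v] ->
  boolean_interval S v (v * set_prod J).
Proof.
move=> comm dis; pose f (A : {set {s | s \in J}}) := v * set_prod (val @: A)%SET.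
have sub (A : {set {s | s \in J}}) : (val @: A)%SET \subset J.
  by apply/fintype.subsetP => _ /imsetP[s _ ->]; apply: valP.
have mono (A B : {set {s | s \in J}}) : (A \subset B) = weak_le S (f A) (f B).
  apply/idP/idP => [AB|/(weak_le_set_sub comm dis (sub A) (sub B))].
    apply: weak_le_set; rewrite ?imsetS ?(disjointWl (sub B)) //.
    exact: commuting_sub (sub B) comm.
  move=> /fintype.subsetP AB; apply/fintype.subsetP => s sA.
  have /AB/imsetP[t tB /val_inj ->] // : val s \in (val @: A)%SET by apply: imset_f.
exists _, f; split => //; split.
- move=> A _; apply/andP; split.
    have -> : v = f finset.set0 by rewrite /f imset0 set_prod0 mulg1.
    by rewrite -mono finset.sub0set.
  exact: weak_le_set.
- move=> A B _ _ fAB; apply/eqP.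
  by rewrite finset.eqEsubset !mono fAB weak_le_refl.
- move=> x /andP[vx /(weak_le_set_interval comm dis vx)[A AJ ->]].
  exists (val @^-1: A)%SET => //; congr (_ * set_prod _); apply/setP => s.
  apply/imsetP/idP => [[t + ->]|sA]; first by rewrite inE.
  by exists (Sub s (fintype.subsetP AJ _ sA)); rewrite ?inE.
Qed.

(** This reads [J] off from [v w_J], and so computes the final bijection. *)
Lemma weak_le_gen_set v J s : commuting J -> [disjoint J & Des S v] ->
  s \notin Des S v -> weak_le S (v * val s) (v * set_prod J) = (s \in J).
Proof.
move=> comm dis sv.
have vs : weak_le S v (v * val s).
  by rewrite /weak_le mulKg len_gen addn1 len_mul_gen.
apply/idP/idP => [/(weak_le_set_interval comm dis vs)[A AJ /mulgI sA]|sJ].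
  apply: (fintype.subsetP AJ); apply: Des_set_prod (commuting_sub AJ comm) _.
  by rewrite -sA inE gen_sqr len1 len_gen.
by rewrite -set_prod1 weak_le_set // finset.sub1set.
Qed.

(** * The shape of an arbitrary Boolean interval *)

Lemma weak_le_cover x z : weak_le S x z -> x != z ->
  exists2 s, s \notin Des S x & weak_le S (x * val s) z.
Proof.
(* The generator sought is the first letter of a reduced word of [x^-1 z]. *)
move=> /eqP; have [[|s d] dxz <-] := reduced_word (x^-1 * z) => lz.
  by rewrite -(mulVKg x z) -dxz word_prod_nil mulg1 eqxx.
have zE : z = x * val s * word_prod d.
  by rewrite -(mulVKg x z) -dxz word_prod_cons mulgA.
move=> _; have le1 := lenM (x * val s) (word_prod d); have le2 := lenM x (val s).
have le3 := len_word d; rewrite -zE lz len_gen /= in le1 le2.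
have lxs : len (x * val s) = (len x).+1.
  apply/eqP; rewrite eqn_leq -{1}addn1 le2 /= -(leq_add2r (size d)) addSnnS.
  by rewrite (leq_trans le1) // leq_add2l.
exists s; first by rewrite Des_gen ?lxs.
rewrite /weak_le lxs lz addSnnS /= zE mulKg eqn_add2l eqSS eqn_leq le3 andbT.
by move: le1; rewrite lxs addSnnS leq_add2l.
Qed.

(** A cover [f A * s] below [f (a |: A)] lies in the interval, so it is [f B] with [B] between [A]
    and [a |: A]; its length excludes [B = A]. *)
Lemma boolean_interval_step v w (X : finType) (f : {set X} -> W) :
  set_bij [set: {set X}]%classic (weak_interval S v w) f ->
  (forall A B : {set X}, (A \subset B) = weak_le S (f A) (f B)) ->
  forall (A : {set X}) a, a \notin A ->
  exists2 s, s \notin Des S (f A) & f (a |: A)%SET = f A * val s.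
Proof.
move=> [fI finj fsurj] mono A a aA.
have finj' : injective f by move=> B C; apply: finj; rewrite in_setE.
have [||s sA le_s] := @weak_le_cover (f A) (f (a |: A)%SET).
- by rewrite -mono finset.subsetUr.
- by apply: contraNneq aA => /finj' ->; rewrite finset.setU11.
exists s => //; have le_A : weak_le S (f A) (f A * val s).
  by rewrite /weak_le mulKg len_gen addn1 len_mul_gen.
have [|B _ Bs] := fsurj (f A * val s).
  have /andP[vA _] := fI A I; have /andP[_ aAw] := fI (a |: A)%SET I.
  by apply/andP; split; [apply: weak_le_trans le_A | apply: weak_le_trans aAw].
rewrite -Bs -!mono in le_s le_A *; congr f; apply/eqP.
rewrite finset.eqEsubset le_s andbT finset.subUset le_A andbT finset.sub1set.
apply: contraT => aB; have := len_mul_gen sA; rewrite -Bs.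
suff -> : B = A by move/eqP; rewrite ltn_eqF.
apply/eqP; rewrite finset.eqEsubset le_A andbT; apply/fintype.subsetP => b bB.
have := fintype.subsetP le_s _ bB; rewrite !inE => /orP[/eqP ba|//].
by rewrite ba (negPf aB) in bB.
Qed.

Lemma boolean_interval_top v w : weak_le S v w -> boolean_interval S v w ->
  exists J : {set S},
    [/\ commuting J, [disjoint J & Des S v] & w = v * set_prod J].
Proof.
move=> vw [X [f [bij mono]]]; have [fI finj fsurj] := bij.
have finj' : injective f by move=> B C; apply: finj; rewrite in_setE.
have step := boolean_interval_step bij mono.
have f0 : f finset.set0 = v.
  have [|A _ Av] := fsurj v; first by rewrite /weak_interval /= weak_le_refl.
  rewrite -Av; congr f; apply/eqP; rewrite finset.eqEsubset finset.sub0set.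
  by rewrite mono Av; have /andP[] := fI finset.set0 I.
have fT : f [set: X]%SET = w.
  have [|A _ Aw] := fsurj w; first by rewrite /weak_interval /= weak_le_refl andbT.
  rewrite -Aw; congr f; apply/eqP; rewrite finset.eqEsubset finset.subsetT andbT.
  by rewrite mono Aw; have /andP[] := fI [set: X]%SET I.
have [g gP] : {g : X -> S & forall a,
    g a \notin Des S v /\ f [set a]%SET = v * val (g a)}.
  apply: (@choice _ _ (fun a s => s \notin Des S v /\ f [set a]%SET = v * val s)).
  move=> a; have [|s] := step finset.set0 a; first by rewrite inE.
  by rewrite f0 finset.setU0; exists s.
(* Opposite sides of the square above [B] carry the same generator, and the two generators
   commute. *)
have diamond (B : {set X}) a b s t : a != b -> a \notin B -> b \notin B ->
    f (a |: B)%SET = f B * val s -> f (b |: B)%SET = f B * val t ->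
    f (a |: (b |: B))%SET = f (b |: B)%SET * val s /\ commute (val s) (val t).
  move=> ab aB bB fa fb.
  have [|s' _ e1] := step (b |: B)%SET a; first by rewrite !inE negb_or ab.
  have [|t' _ e2] := step (a |: B)%SET b.
    by rewrite !inE negb_or eq_sym ab.
  have e : val t * val s' = val s * val t' :> W.
    by apply: (mulgI (f B)); rewrite !mulgA -fa -fb -e1 -e2 finset.setUCA.
  have ts : t != s.
    apply: contraNneq ab => ts; have /finj' eB : f (a |: B)%SET = f (b |: B)%SET.
      by rewrite fa fb ts.
    by have := setU11 a B; rewrite eB !inE (negPf aB) orbF.
  have st : s != t by rewrite eq_sym.
  (* Otherwise the second step would undo the first, and the top of the square would be [f B]. *)
  have ts' : t != s'.
    apply: contraNneq aB => ts'.
    have /finj' <- : f (a |: (b |: B))%SET = f B by rewrite e1 fb ts' mulg_genK.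
    exact: setU11.
  have st' : s != t'.
    apply: contraNneq bB => st'.
    have /finj' <- : f (a |: (b |: B))%SET = f B.
      by rewrite finset.setUCA e2 fa st' mulg_genK.
    by rewrite finset.setUCA setU11.
  have s's := two_letters ts ts' e.
  have t't := two_letters st st' (esym e).
  by rewrite s's in e e1; rewrite t't in e; rewrite e1 /commute.
(* The label [g a] of an atom propagates upwards: for [b] in [A], the square above [A :\ b] carries
   it to the edge leaving [A]. *)
have fU (A : {set X}) a : a \notin A -> f (a |: A)%SET = f A * val (g a).
  elim: {A}_.+1 {-2}A (ltnSn #|A|) a => // n IHn A; rewrite ltnS => An a aA.
  have [->|[b bA]] := finset.set_0Vmem A.
    by rewrite finset.setU0 f0; have [] := gP a.
  have bB : b \notin (A :\ b)%SET by rewrite !inE eqxx.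
  have aB : a \notin (A :\ b)%SET by rewrite !inE (negPf aA) andbF.
  have ab : a != b by apply: contraNneq aA => ->.
  have Bn : #|(A :\ b)%SET| < n by move: An; rewrite (cardsD1 b A) bA.
  have [] := diamond _ a b (g a) (g b) ab aB bB (IHn _ Bn a aB) (IHn _ Bn b bB).
  by rewrite finset.setD1K.
have gcomm : commuting [set g a | a in X]%SET.
  move=> _ _ /imsetP[a _ ->] /imsetP[b _ ->].
  have [->//|ab] := eqVneq a b.
  by case: (diamond finset.set0 a b (g a) (g b)) => //; rewrite ?inE ?fU ?inE.
(* Distinct labels ensure that each added element of [X] contributes a new generator to the
   product. *)
have ginj : injective g.
  move=> a b gab; have [_ fa] := gP a; have [_ fb] := gP b.
  by apply/finset.set1_inj/finj'; rewrite fa fb gab.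
exists [set g a | a in X]%SET; split => //.
  rewrite disjoint_subset; apply/fintype.subsetP => _ /imsetP[a _ ->].
  by rewrite inE; have [] := gP a.
have fE (A : {set X}) : f A = v * set_prod (g @: A)%SET.
  elim: {A}_.+1 {-2}A (ltnSn #|A|) => // n IHn A; rewrite ltnS => An.
  have [->|[b bA]] := finset.set_0Vmem A.
    by rewrite imset0 set_prod0 mulg1.
  have bB : b \notin (A :\ b)%SET by rewrite !inE eqxx.
  rewrite -(finset.setD1K bA) fU // IHn; last first.
    by move: An; rewrite (cardsD1 b A) bA.
  rewrite imsetU1 set_prodU1 ?mulgA //; last by rewrite mem_imset.
  apply: commuting_sub gcomm; rewrite -imsetU1; apply: imsetS.
  exact/fintype.subsetP.
rewrite -fT fE; congr (_ * set_prod _); apply/setP => s.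
by apply/imsetP/imsetP => -[a _ ->]; exists a.
Qed.

(** * Non-adjacency in the Coxeter graph, and the bijection *)

Lemma cox_edgePn s t : s != t ->
  reflect (commute (val s) (val t)) (~~ cox_edge S s t).
Proof.
move=> st; rewrite /cox_edge /cox_matrix; apply: (iffP idP) => [|comm].
  (* Infinite order counts as an edge, so the order is 1 or 2; order 1 would give [s = t], and order
     2 is commutation. *)
  case e: elt_order => [n|] //; have [n_gt0 stn _] := elt_order_SomeP e.
  case: n n_gt0 stn {e} => [|[|[|n]]] // _; rewrite ?expg1 ?expg2 => e _.
    case/eqP: st; apply: val_inj; have := congr1 ( *%g^~ (val t)) e.
    by rewrite /= mulg_genK mul1g.
  have := congr1 (fun x => val t * (val s * x)) e.
  by rewrite /= mulg1 -!mulgA !mul_genK.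
have st2 : (val s * val t) ^+ 2 = 1.
  by rewrite expg2 {2}comm mulgA mulg_genK gen_sqr.
case e: elt_order => [n|].
  by have [_ _ /(_ 2)] := elt_order_SomeP e; rewrite -ltnNge; apply.
by move: e; rewrite /elt_order; case: pselect => // -[]; exists 2; rewrite st2 eqxx.
Qed.

End CoxeterSystem.

Theorem theorem1p2 (W : groupType) (S : {fset W}) (v : W) :
  coxeter_system S ->
  exists f : W -> {set {s : S | s \in ~: Des S v}},
    set_bij
      [set w : W | weak_le S v w /\ boolean_interval S v w]%classic
      [set I : {set {s : S | s \in ~: Des S v}} |
        independent (induced_subgraph (cox_edge S) (~: Des S v)) I]%classic
      f.
Proof.
move=> cox; pose T := {s : S | s \in ~: Des S v}%SET.
exists (fun w => [set x : T | weak_le S (v * val (val x)) w])%SET.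
have TDes (x : T) : val x \notin Des S v by have := valP x; rewrite inE.
(* On [v w_J] the map returns [J] itself, viewed inside the complement of the descents. *)
have PhiE J : commuting J -> [disjoint J & Des S v] ->
    [set x : T | weak_le S (v * val (val x)) (v * set_prod J)]%SET =
    (val @^-1: J)%SET.
  by move=> comm dis; apply/setP => x; rewrite !inE weak_le_gen_set.
split.
- move=> w [vw /(boolean_interval_top cox vw)[J [comm dis ->]]] /=.
  rewrite PhiE // => x y; rewrite !inE => xJ yJ xy.
  by apply/(cox_edgePn cox); [rewrite (inj_eq val_inj) | apply: comm].
- move=> w1 w2; rewrite !in_setE /=.
  move=> [vw /(boolean_interval_top cox vw)[J1 [comm1 dis1 ->]]] {vw}.
  move=> [vw /(boolean_interval_top cox vw)[J2 [comm2 dis2 ->]]].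
  rewrite !PhiE // => /setP eJ; congr (_ * set_prod _); apply/setP => s.
  (* Both sets avoid the descents of [v], so only generators in the vertex set of the subgraph need
     comparing. *)
  have [sv|sv] := boolP (s \in Des S v).
    by rewrite (disjointFl dis1) ?(disjointFl dis2).
  have sT : s \in (~: Des S v)%SET by rewrite inE.
  by have := eJ (Sub s sT); rewrite !inE.
- move=> I /= indI; pose J := (val @: I)%SET.
  have comm : commuting J.
    move=> _ _ /imsetP[x xI ->] /imsetP[y yI ->].
    have [->//|xy] := eqVneq x y.
    by apply/(cox_edgePn cox); [rewrite (inj_eq val_inj) | apply: indI].
  have dis : [disjoint J & Des S v].
    rewrite disjoint_subset; apply/fintype.subsetP => _ /imsetP[x _ ->].
    by rewrite inE.
  exists (v * set_prod J); first split.
  + have := weak_le_set cox comm dis (finset.sub0set J).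
    by rewrite set_prod0 mulg1.
  + exact: boolean_interval_set.
  + rewrite PhiE //; apply/setP => x; rewrite inE mem_imset //.
Qed.
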